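(* Let $p$ be a prime, $N=p^e$ with $e\ge1$, let $h\ge1$ be a divisor of $N-1$, put $A=(N-1)/h$ and $\Lambda_{N,h}(U)=U(U^A-1)^h\in\mathbb F_p[U]$. Let $Q=p^m$ with $m\ge1$ and put $$s=p^{\gcd(e,m)},\qquad C=\frac{N-1}{s-1},\qquad \kappa=\gcd(h,C).$$ For $t\in\mathbb F_Q$ let $r_Q(t)=\#\{u\in\mathbb F_Q:\Lambda_{N,h}(u)=t\}$. Then $$r_Q(0)=1+\frac{\kappa(s-1)}{h}.$$ Among nonzero target values $t\in\mathbb F_Q^\times$, the only possible values of $r_Q(t)$ are $0$, $1$ and $s$, and $$\#\{t\in\mathbb F_Q^\times:r_Q(t)=0\}=\frac{\kappa(s-1)Q}{hs},$$ $$\#\{t\in\mathbb F_Q^\times:r_Q(t)=1\}=\frac{(h-\kappa)(Q-1)}{h},$$ $$\#\{t\in\mathbb F_Q^\times:r_Q(t)=s\}=\frac{\kappa(Q-s)}{hs}.$$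
   Context: Fibres are counted as sets of $\mathbb F_Q$-rational points, without multiplicity. Since $\gcd(e,m)\mid e$, the number $s-1$ divides $N-1$, so $C$ is an integer. *)

(* Defs.v *)
From HB Require Import structures.
From mathcomp Require Import all_boot all_order all_algebra.

Set Implicit Arguments.
Unset Strict Implicit.
Unset Printing Implicit Defensive.

Import GRing.Theory.
Local Open Scope ring_scope.

(* [(N - 1) %/ h] is the exact quotient A = (N - 1) / h when h divides N - 1. *)
Definition Lambda (p N h : nat) : {poly 'F_p} :=
  'X * ('X^((N - 1) %/ h) - 1) ^+ h.

(* For p prime and F of characteristic p, [fun c : 'F_p => c%:R] is the unique
   ring morphism from 'F_p to F, so this is evaluation at a point of F of a
   polynomial over the prime field. *)
Definition eval_Fp (p : nat) (F : finFieldType) (P : {poly 'F_p}) (u : F) : F :=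
  (map_poly (fun c : 'F_p => (c : nat)%:R : F) P).[u].

(* Number of points of F, without multiplicity, in the fibre over t. *)
Definition fibre_card (p : nat) (F : finFieldType) (P : {poly 'F_p}) (t : F) :
    nat :=
  #|[set u : F | eval_Fp P u == t]|.

(* Main.v *)
Require Import Defs.
From HB Require Import structures.
From mathcomp Require Import all_boot all_order all_algebra all_field.
From mathcomp Require Import cyclic ring zify.

Set Implicit Arguments.
Unset Strict Implicit.
Unset Printing Implicit Defensive.

Import GRing.Theory.
Local Open Scope ring_scope.

(* For t <> 0 the substitution z = (u^A - 1)^-1, with inverse u = t z^h, carries
   the fibre over t to the solutions of t^A z^N - z = 1.  The left-hand side is
   additive in z, so there are 0 or #ker solutions, and exactly one if the kernel
   is trivial.  The kernel is nontrivial, and then has s elements, exactly when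
   t^A is an (N-1)-th power in F, that is, when (t^A)^((Q-1)/(s-1)) = 1; there are
   kappa (Q-1)/h such t.  Summing the fibre cardinals to Q gives the counts. *)

(** * Evaluation of [Lambda] in [F], and gcds of the numbers [p ^ i - 1] *)

Lemma eval_Fp_Lambda (p N h : nat) (F : finFieldType) (u : F) :
  p \in [pchar F] ->
  eval_Fp (Lambda p N h) u = u * (u ^+ ((N - 1) %/ h) - 1) ^+ h.
Proof.
move=> pF; have p_pr := pcharf_prime pF.
pose f (c : 'F_p) : F := (c : nat)%:R.
have modK k : (k %% (Zp_trunc (pdiv p)).+2)%:R = k%:R :> F.
  by rewrite Fp_cast // (GRing.natr_mod_pchar pF).
have fB : {morph f : x y / x - y}.
  (* Subtraction is traded for addition: a sum in ['F_p] is the remainder of a sum of naturals, so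
     [modK] applies to it. *)
  move=> x y; apply: (addIr (f y)).
  rewrite subrK -natrD -modK.
  by rewrite -[in RHS](subrK y x) /f /= modK.
have fM : monoid_morphism f.
  by split=> [|x y]; rewrite /f /= modK // natrM.
pose fR : {rmorphism 'F_p -> F} := HB.pack f
  (GRing.isZmodMorphism.Build _ _ f fB) (GRing.isMonoidMorphism.Build _ _ f fM).
suff E (g : {rmorphism 'F_p -> F}) :
    (map_poly g (Lambda p N h)).[u] = u * (u ^+ ((N - 1) %/ h) - 1) ^+ h.
  exact: E fR.
by rewrite rmorphM rmorphXn rmorphB rmorphXn rmorph1 /= map_polyX !hornerE.
Qed.

(** Euclid's algorithm on the exponents: for [i <= j], modulo [p ^ i - 1] the number [p ^ j - 1] is
    congruent to [p ^ (j - i) - 1] up to a multiple. For [p = 0] all these numbers are 0 by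
    truncated subtraction, which is treated apart. *)
Lemma gcdn_predn_exp (p i j : nat) :
  gcdn (p ^ i - 1) (p ^ j - 1) = (p ^ gcdn i j - 1)%N.
Proof.
have [->|p_gt0] := posnP p.
  case: i => [|i]; first by rewrite gcd0n gcd0n.
  case: j => [|j]; first by rewrite gcdn0 gcdn0.
  by rewrite !exp0n ?gcdn_gt0.
have [k] := ubnP (i + j)%N; elim: k i j => // k IHk.
suff step i j : (i <= j)%N -> (i + j < k.+1)%N ->
    gcdn (p ^ i - 1) (p ^ j - 1) = (p ^ gcdn i j - 1)%N.
  move=> i j ijk; have [/step-> //|/ltnW ji] := leqP i j.
  by rewrite gcdnC [gcdn i j]gcdnC step // addnC.
move=> ij ijk; have [->|i_gt0] := posnP i; first by rewrite !gcd0n.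
rewrite -(subnKC ij) gcdnDl -IHk; last by lia.
have -> : (p ^ (i + (j - i)) - 1 =
           p ^ (j - i) * (p ^ i - 1) + (p ^ (j - i) - 1))%N.
  by rewrite expnD; have := expn_gt0 p i; have := expn_gt0 p (j - i); nia.
by rewrite gcdnMDl.
Qed.

(** * Power equations in the cyclic group of units of a finite field *)

Lemma expf_card_pred (F : finFieldType) (x : F) : x != 0 -> x ^+ #|F|.-1 = 1.
Proof.
move=> x0; apply: (mulIf x0).
by rewrite -exprSr prednK ?expf_card ?mul1r // ltnW ?finNzRing_gt1.
Qed.

Lemma finField_prim_root (F : finFieldType) :
  exists z : F, (#|F|.-1).-primitive_root z.
Proof.
have : has (#|F|.-1).-primitive_root [seq x <- enum F | x != 0].
  apply: has_prim_root.
  - by rewrite -subn1 subn_gt0 finNzRing_gt1.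
  - apply/allP => x; rewrite mem_filter => /andP[x0 _].
    by rewrite unity_rootE expf_card_pred.
  - exact/filter_uniq/enum_uniq.
  - rewrite -(cardC1 (0 : F)) cardE leq_eqVlt; apply/orP; left; apply/eqP.
    congr size; rewrite /enum_mem -filter_predI.
    by apply: eq_filter => x; rewrite /= !inE andbT.
by case/hasP => z _ zP; exists z.
Qed.

Section PowerEquations.

Variable F : finFieldType.
Let n := #|F|.-1.

(** By Bezout, [x ^+ k = 1] and [x ^+ n = 1] together give [x ^+ gcdn k n = 1], so the solutions are
    the powers of one primitive root of unity of order [gcdn k n]. *)
Lemma card_unity_root (k : nat) : (0 < k)%N ->
  #|[set x : F | x ^+ k == 1]| = gcdn k n.
Proof.
move=> k_gt0; have [z zP] := finField_prim_root F.
have wP := dvdn_prim_root zP (dvdn_gcdr k n); set w := z ^+ _ in wP.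
have -> : [set x : F | x ^+ k == 1] =
    [set w ^+ (i : 'I_(gcdn k n)) | i : 'I_(gcdn k n)].
  apply/setP => x; rewrite inE; apply/eqP/imsetP => [xk1|[i _ ->]].
    have x0 : x != 0.
      apply: contra_eq_neq xk1 => ->.
      by rewrite expr0n gtn_eqF // eq_sym oner_eq0.
    have [|i ->] := prim_rootP wP (x := x); last by exists i.
    have [u _ /dvdnP[v uvE]] := Bezoutl n k_gt0.
    have : x ^+ (gcdn k n + u * n) = 1 by rewrite uvE mulnC exprM xk1 expr1n.
    by rewrite exprD [(u * n)%N]mulnC exprM expf_card_pred // expr1n mulr1.
  have /eqP wk1 : w ^+ k == 1 by rewrite -(prim_order_dvd wP) dvdn_gcdl.
  by rewrite exprAC wk1 expr1n.
rewrite card_imset ?card_ord // => i j /eqP.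
by rewrite (eq_prim_root_expr wP) !modn_small // => /eqP/val_inj.
Qed.

(** In the cyclic group of order [n], the [k]-th powers are exactly the elements killed by
    [n %/ gcdn k n]; when solutions exist, they form a coset of the [k]-th roots of unity. *)
Lemma card_mul_expr_eq1 (k : nat) (a : F) : (0 < k)%N -> a != 0 ->
  #|[set x : F | a * x ^+ k == 1]| =
    if a ^+ (n %/ gcdn k n) == 1 then gcdn k n else 0%N.
Proof.
move=> k_gt0 a0; set d := gcdn k n.
have n_gt0 : (0 < n)%N by rewrite /n -subn1 subn_gt0 finNzRing_gt1.
case: ifP => [/eqP ad1|ad].
  have [z zP] := finField_prim_root F.
  have [i aE] := prim_rootP zP (expf_card_pred a0).
  have d_dvd_i : (d %| i)%N.
    move/eqP: ad1; rewrite aE -exprM -(prim_order_dvd zP) -/n.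
    rewrite -{1}(divnK (dvdn_gcdr k n)) -/d mulnC dvdn_pmul2r //.
    rewrite divn_gt0 ?gcdn_gt0 ?k_gt0 //; exact: dvdn_leq (dvdn_gcdr k n).
  have [u _ /dvdnP[v uvE]] := Bezoutr k n_gt0.
  have [j iE] := dvdnP d_dvd_i.
  (* With [a = z ^+ (j * d)] and the Bezout relation [d + u * k = v * n], the choice
     [b = z ^+ (j * u)] makes the total exponent a multiple of [n]. *)
  have : exists2 b, b != 0 & a * b ^+ k = 1.
    exists (z ^+ (j * u)).
      by rewrite expf_neq0 // (prim_root_eq0 zP) -lt0n.
    rewrite aE -exprM -exprD iE.
    have -> : (j * d + j * u * k = n * (j * v))%N.
      by rewrite -mulnA -mulnDr uvE; ring.
    by rewrite exprM (prim_expr_order zP) expr1n.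
  case=> b b0 abk; rewrite /d -(card_unity_root k_gt0).
  have -> : [set x | a * x ^+ k == 1] =
      [set b * y | y in [set y : F | y ^+ k == 1]].
    apply/setP => x; rewrite inE; apply/eqP/imsetP => [axk|[y]]; last first.
      by rewrite inE => /eqP yk ->; rewrite exprMn mulrA abk yk mulr1.
    exists (x / b); last by rewrite mulrC divfK.
    have xbk : x ^+ k = b ^+ k by apply: (mulfI a0); rewrite axk abk.
    by rewrite inE expr_div_n xbk divff // expf_neq0.
  by rewrite card_imset //; apply: mulfI.
apply/eqP; rewrite cards_eq0 -subset0.
apply/subsetP => x; rewrite !inE => /eqP axk.
have x0 : x != 0.
  apply: contra_eq_neq axk => ->.
  by rewrite expr0n gtn_eqF // mulr0 eq_sym oner_eq0.
case/negP: (negbT ad); apply/eqP.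
(* The factor [x] disappears because [k * (n %/ d)] is a multiple of [n]. *)
have <- : (a * x ^+ k) ^+ (n %/ d) = a ^+ (n %/ d); last by rewrite axk expr1n.
rewrite exprMn -exprM.
by rewrite muln_divCA_gcd exprM expf_card_pred // expr1n mulr1.
Qed.

End PowerEquations.

(** * From nonzero fibres to affine equations with an additive left-hand side *)

Lemma card_fibre_affine (F : finFieldType) (A h : nat) (t : F) :
  (0 < h)%N -> t != 0 ->
  #|[set u : F | u * (u ^+ A - 1) ^+ h == t]| =
  #|[set z : F | t ^+ A * z ^+ (A * h).+1 - z == 1]|.
Proof.
move=> h0 t0; pose f (u : F) := (u ^+ A - 1)^-1.
(* On a fibre over [t != 0] the inverse defining [f] is a genuine one, never the default
   [0^-1 = 0]. *)
have nz u : u * (u ^+ A - 1) ^+ h = t -> u ^+ A - 1 != 0.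
  by move=> E; apply: contraNneq t0 => w0; rewrite -E w0 expr0n gtn_eqF // mulr0.
have fK u : u * (u ^+ A - 1) ^+ h = t -> t * f u ^+ h = u.
  by move=> E; rewrite -{1}E /f exprVn mulfK // expf_neq0 // nz.
have <- : f @: [set u : F | u * (u ^+ A - 1) ^+ h == t] =
    [set z : F | t ^+ A * z ^+ (A * h).+1 - z == 1].
  apply/setP => z; rewrite inE; apply/imsetP/eqP => [[u]|zE].
    rewrite inE => /eqP uE ->; have w0 := nz _ uE.
    have -> : t ^+ A * f u ^+ (A * h).+1 = u ^+ A * f u.
      by rewrite exprSr mulrA mulnC exprM -exprMn fK.
    by rewrite -[X in _ - X]mul1r -mulrBl /f divff.
  have z0 : z != 0.
    apply: contra_eq_neq zE => ->.
    by rewrite expr0n /= mulr0 subr0 eq_sym oner_eq0.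
  have E : (t * z ^+ h) ^+ A - 1 = z^-1.
    apply: (mulIf z0); rewrite mulVf // mulrBl mul1r.
    by rewrite exprMn -exprM -mulrA -exprSr mulnC.
  exists (t * z ^+ h); last by rewrite /f E invrK.
  by rewrite inE E exprVn mulfK // expf_neq0.
rewrite card_in_imset // => u v; rewrite !inE => /eqP uE /eqP vE fE.
by rewrite -(fK _ uE) -(fK _ vE) fE.
Qed.

(** A nonempty fibre is a translate of the kernel. An empty one excludes a trivial kernel, since an
    injective self-map of a finite set is onto. *)
Lemma card_additive_fibre (F : finZmodType) (L : {additive F -> F}) (b : F) :
  let K := #|[set z | L z == 0]| in
  #|[set z | L z == b]| = K \/ #|[set z | L z == b]| = 0%N /\ K != 1%N.
Proof.
move=> K; have [z0 z0E|noz] := pickP [pred z | L z == b].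
  left; rewrite -[RHS](card_imset _ (addrI z0)); congr #|pred_of_set _|.
  apply/setP=> z; rewrite inE; apply/eqP/imsetP => [zE|[y]].
    exists (z - z0); last by rewrite addrC subrK.
    by rewrite inE raddfB zE (eqP z0E) subrr.
  by rewrite inE => /eqP yE ->; rewrite raddfD yE addr0 (eqP z0E).
right; split.
  by apply/eqP; rewrite cards_eq0; apply/eqP/setP=> z; rewrite !inE; apply: noz.
apply/negP=> /cards1P[c cE].
have c0 : 0 = c by apply/set1P; rewrite -cE inE raddf0.
have Linj : injective L.
  move=> x y Exy; apply/eqP; rewrite -subr_eq0 c0; apply/eqP/set1P.
  by rewrite -cE inE raddfB Exy subrr.
by have := noz (invF Linj b); rewrite /= f_invF eqxx.
Qed.

Lemma card_affine_trinomial (p e m : nat) (F : finFieldType) (a : F) :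
  prime p -> (0 < e)%N -> #|F| = (p ^ m)%N -> a != 0 ->
  let s := (p ^ gcdn e m)%N in
  let R := #|[set z : F | a * z ^+ (p ^ e) - z == 1]| in
  if a ^+ ((p ^ m - 1) %/ (s - 1)) == 1 then R = 0%N \/ R = s else R = 1%N.
Proof.
move=> p_pr e0 cardF a0 s R.
have pF := card_finPcharP cardF p_pr.
have s_gt1 : (1 < s)%N.
  by rewrite -(exp1n (gcdn e m)) ltn_exp2r ?prime_gt1 ?gcdn_gt0 ?e0.
have N_gt1 : (1 < p ^ e)%N by rewrite -(exp1n e) ltn_exp2r ?prime_gt1.
pose f (z : F) := a * z ^+ (p ^ e) - z.
have fB : {morph f : x y / x - y}.
  have pN : [pchar F].-nat (p ^ e)%N by rewrite pnatX pnatE ?pF.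
  move=> x y; rewrite /f exprDn_pchar // exprNn_pchar //; ring.
(* A nonzero kernel element satisfies [a * z ^+ (p ^ e - 1) = 1], and [gcdn (p ^ e - 1) (p ^ m - 1)]
   is [s - 1]. *)
have cardK : #|[set z : F | f z == 0]| =
    (1 + if (a ^+ ((p ^ m - 1) %/ (s - 1))%N == 1)%R then s - 1 else 0)%N.
  have -> : [set z : F | f z == 0] = 0 |: [set z | a * z ^+ (p ^ e - 1) == 1].
    apply/setP => z; rewrite !inE /f -[(p ^ e)%N](subnK (ltnW N_gt1)) addn1 exprSr.
    rewrite mulrA -[X in _ - X]mul1r -mulrBl mulf_eq0 subr_eq0 orbC.
    by rewrite subSS subn0.
  rewrite cardsU1 inE expr0n subn_eq0 leqNgt N_gt1 mulr0 eq_sym oner_eq0 /=.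
  rewrite card_mul_expr_eq1 ?subn_gt0 //.
  by rewrite cardF -subn1 gcdn_predn_exp.
have := card_additive_fibre
  (HB.pack f (GRing.isZmodMorphism.Build _ _ f fB) : {additive F -> F}) 1.
rewrite /= -/R cardK; case: ifP => _; last by case=> // -[].
by rewrite subnKC ?(ltnW s_gt1) //; case=> [|[]]; [right|left].
Qed.

(** * Counting identities and the final linear system *)

Lemma card_sum_fibres (T U : finType) (f : T -> U) :
  #|T| = (\sum_(y : U) #|[set x | f x == y]|)%N.
Proof.
rewrite -sum1_card (partition_big f predT) //=; apply: eq_bigr => y _.
by rewrite -sum1dep_card.
Qed.

(** Both sides are the gcd of [A * h = C * s] with [h * s]. Used with [s - 1] in place of [s], it
    brings [kappa] into the counts. *)
Lemma muln_gcd_quotients (A h s C : nat) :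
  (A * h = C * s)%N -> (h * gcdn A s = gcdn h C * s)%N.
Proof. by move=> E; rewrite muln_gcdr muln_gcdl -E [(A * h)%N]mulnC gcdnC. Qed.

(** The unknowns are the numbers [n0], [n1], [ns] of nonzero targets with fibres of size 0, 1 and
    [s]; [g] counts the nonzero zeros and [b] the targets with nontrivial kernel. The system is
    triangular: first [n1], then [ns], then [n0]. *)
Lemma fibre_counts_solution (K : fieldType) (h k q s b g n0 n1 ns : K) :
  h != 0 -> s != 0 -> h * g = k * (s - 1) -> h * b = k * (q - 1) ->
  q = 1 + g + (n1 + s * ns) -> n1 + b = q - 1 -> n0 + ns = b ->
  [/\ 1 + g = 1 + k * (s - 1) / h, n0 = k * (s - 1) * q / (h * s),
      n1 = (h - k) * (q - 1) / h & ns = k * (q - s) / (h * s)].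
Proof.
move=> h0 s0 hg hb sum_q n1b n0ns.
have gE : g = k * (s - 1) / h by rewrite -hg mulrC mulKf.
have bE : b = k * (q - 1) / h by rewrite -hb mulrC mulKf.
have n1E : n1 = (h - k) * (q - 1) / h.
  by rewrite -(addrK b n1) n1b bE; field.
have nsE : ns = k * (q - s) / (h * s).
  apply: (mulfI s0); have -> : s * ns = q - 1 - g - n1 by rewrite sum_q; ring.
  by rewrite gE n1E; field; apply/andP.
split=> //; first by rewrite gE.
by rewrite -(addrK ns n0) n0ns bE nsE; field; apply/andP.
Qed.

Theorem theorem4p2
  (p e m h N Q s C kappa : nat)
  (p_prime : prime p)
  (e_ge1 : (1 <= e)%N) (N_def : N = (p ^ e)%N)
  (h_ge1 : (1 <= h)%N) (h_dvd : (h %| N - 1)%N)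
  (m_ge1 : (1 <= m)%N) (Q_def : Q = (p ^ m)%N)
  (s_def : s = (p ^ gcdn e m)%N)
  (C_def : C = ((N - 1) %/ (s - 1))%N)
  (kappa_def : kappa = gcdn h C)
  (F : finFieldType) (F_card : #|F| = Q) :
  let r := fun t : F => fibre_card (Lambda p N h) t in
  [/\ (r 0)%:R = 1 + kappa%:R * (s%:R - 1) / h%:R :> rat,
      forall t : F, t != 0 -> [\/ r t = 0%N, r t = 1%N | r t = s],
      #|[set t : F | (t != 0) && (r t == 0%N)]|%:R
        = kappa%:R * (s%:R - 1) * Q%:R / (h%:R * s%:R) :> rat,
      #|[set t : F | (t != 0) && (r t == 1%N)]|%:R
        = (h%:R - kappa%:R) * (Q%:R - 1) / h%:R :> rat
    & #|[set t : F | (t != 0) && (r t == s)]|%:R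
        = kappa%:R * (Q%:R - s%:R) / (h%:R * s%:R) :> rat].
Proof.
move=> r.
have s_gt1 : (1 < s)%N.
  by rewrite s_def -(exp1n (gcdn e m)) ltn_exp2r ?prime_gt1 ?gcdn_gt0 ?e_ge1.
have N_gt1 : (1 < N)%N by rewrite N_def -(exp1n e) ltn_exp2r ?prime_gt1.
have Q_gt1 : (1 < Q)%N by rewrite Q_def -(exp1n m) ltn_exp2r ?prime_gt1.
have s1N1 : (s - 1 %| N - 1)%N by rewrite s_def N_def -gcdn_predn_exp dvdn_gcdl.
have s1Q1 : (s - 1 %| Q - 1)%N by rewrite s_def Q_def -gcdn_predn_exp dvdn_gcdr.
set A := ((N - 1) %/ h)%N.
have AhE : (A * h = N - 1)%N by rewrite /A divnK.
have A_gt0 : (0 < A)%N by rewrite divn_gt0 // dvdn_leq // subn_gt0.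
pose g := gcdn A (s - 1).
have hg : (h * g = kappa * (s - 1))%N.
  by rewrite kappa_def; apply: muln_gcd_quotients; rewrite AhE C_def divnK.
have rE t : r t = #|[set u : F | u * (u ^+ A - 1) ^+ h == t]|.
  rewrite /r /fibre_card; congr #|pred_of_set _|; apply/setP => u; rewrite !inE.
  by rewrite eval_Fp_Lambda // (card_finPcharP _ p_prime (n := m)) // F_card.
have r0E : r 0 = (1 + g)%N.
  have -> : r 0 = #|0 |: [set u : F | u ^+ A == 1]|.
    rewrite rE; congr #|pred_of_set _|; apply/setP => u; rewrite !inE.
    by rewrite mulf_eq0 expf_eq0 h_ge1 subr_eq0.
  rewrite cardsU1 inE expr0n gtn_eqF // eq_sym oner_eq0 card_unity_root //=.
  (* Since [A] divides [N - 1], its gcd with [Q - 1] is already its gcd with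
     [gcdn (N - 1) (Q - 1) = s - 1]. *)
  rewrite F_card -subn1 /g s_def Q_def -gcdn_predn_exp gcdnA.
  by congr (_ + gcdn _ _)%N; apply/esym/gcdn_idPl; rewrite -N_def -AhE dvdn_mulr.
pose c := ((Q - 1) %/ (s - 1))%N.
have c_gt0 : (0 < c)%N by rewrite divn_gt0 ?subn_gt0 // dvdn_leq // subn_gt0.
(* These are the [t] whose additive map has a nontrivial kernel. As [Q - 1 = c * (s - 1)], their
   number is [gcdn (A * c) (Q - 1) = c * g]. *)
pose B := [set t : F | t ^+ (A * c) == 1].
have hB : (h * #|B| = kappa * (Q - 1))%N.
  rewrite card_unity_root ?muln_gt0 ?A_gt0 // F_card -subn1.
  rewrite -{1}(divnK s1Q1) -/c [(A * c)%N]mulnC -muln_gcdr mulnCA -/g hg.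
  by rewrite mulnCA divnK.
have rB (t : F) : t != 0 -> if t \in B then r t = 0%N \/ r t = s else r t = 1%N.
  have AhS : (A * h).+1 = (p ^ e)%N.
    by rewrite AhE -addn1 subnK ?N_def // -N_def ltnW.
  move=> t0; rewrite rE card_fibre_affine // AhS inE exprM /c Q_def s_def.
  by apply: card_affine_trinomial; rewrite ?expf_neq0 ?F_card.
pose n (k : nat) := #|[set t : F | (t != 0) && (r t == k)]|.
have nE (k : nat) : n k = (\sum_(t : F | t != 0%R) (r t == k))%N.
  by rewrite /n -sum1dep_card big_mkcondr; apply: eq_bigr => t _; case: eqP.
have s10 : (0%N == s) = false /\ (1%N == s) = false by split; apply/eqP; lia.
(* The fibres partition [F], and those over nonzero targets contribute only sizes 0, 1 and [s]. *)
have sum_r : (Q = r 0%R + (n 1%N + s * n s))%N.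
  rewrite -F_card (card_sum_fibres (fun u : F => u * (u ^+ A - 1) ^+ h)).
  rewrite (bigD1 0) //= -rE; congr (_ + _)%N; rewrite !nE big_distrr -big_split.
  apply: eq_bigr => t t0; rewrite -rE /=; have := rB t t0.
  case: ifP => _; last by move->; rewrite s10.2 muln0.
  by case=> ->; rewrite ?s10.1 ?muln0 // eqxx eq_sym s10.2 muln1.
have B0 : 0 \notin B.
  by rewrite inE expr0n gtn_eqF ?muln_gt0 ?A_gt0 // eq_sym oner_eq0.
(* As [s] is not 1, singleton fibres lie exactly over the nonzero [t] outside [B]. *)
have n1B : (n 1%N + #|B| = Q - 1)%N.
  have -> : n 1%N = #|[set t : F | t != 0] :\: B|.
    congr #|pred_of_set _|; apply/setP => t; rewrite in_setD !in_set andbC.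
    case: (eqVneq t 0) => [|t0]; rewrite /= ?andbF //.
    have := rB t t0; rewrite in_set; case: ifP => _; last by move->.
    by case=> ->; rewrite // eq_sym s10.2.
  have BT : B \subset [set t : F | t != 0].
    by apply/subsetP => t tB; rewrite inE; apply: contraTneq tB => ->.
  rewrite cardsD (setIidPr BT) subnK ?subset_leq_card //.
  by rewrite -F_card subn1 -(cardC1 (0 : F)); apply: eq_card => t; rewrite !inE.
have n0sB : (n 0%N + n s = #|B|)%N.
  rewrite !nE -big_split -sum1_card /= [RHS]big_mkcond [RHS](bigD1 (0 : F)) //=.
  rewrite (negPf B0) add0n.
  apply: eq_bigr => t t0; have := rB t t0.
  case: ifP => _; last by move->; rewrite s10.2.
  by case=> ->; rewrite ?s10.1 // eqxx eq_sym; case: eqP => //; lia.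
have h0 : h%:R != 0 :> rat by rewrite Num.Theory.pnatr_eq0 -lt0n.
have s0 : s%:R != 0 :> rat by rewrite Num.Theory.pnatr_eq0; lia.
have Q1E : (Q - 1)%:R = Q%:R - 1 :> rat by rewrite natrB // ltnW.
have s1E : (s - 1)%:R = s%:R - 1 :> rat by rewrite natrB // ltnW.
have [|||||g_rat n0_rat n1_rat ns_rat] := @fibre_counts_solution rat h%:R kappa%:R
  Q%:R s%:R #|B|%:R g%:R (n 0%N)%:R (n 1%N)%:R (n s)%:R h0 s0.
- by rewrite -s1E -!natrM hg.
- by rewrite -Q1E -!natrM hB.
- by rewrite {1}sum_r r0E !natrD natrM.
- by rewrite -Q1E -natrD n1B.
- by rewrite -natrD n0sB.
split=> //; first by rewrite r0E natrD.
move=> t t0; have := rB t t0.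
by case: ifP => _; [case=> ->; [constructor 1|constructor 3]|move->; constructor 2].
Qed.
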